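(* Fix $p\in(\tfrac14,\tfrac13]$ and $\mathbf s,\mathbf r,\mathbf t\in\mathds S$, and let $\mathcal F=\mathcal F(\mathbf s,\mathbf t,\mathbf r)$ be the corresponding generalised $p$-Koch snowflake with its parameterisation $\gamma:[0,1]\to\mathcal F$. If the restriction of $\gamma$ to $[0,1)$ is injective, then $\mathcal F$ is a Jordan curve (i.e. homeomorphic to the unit circle). In particular, this is the case whenever $p\in(\tfrac14,\tfrac13)$.
   Context: Notation: $\mathbb N=\{1,2,\dots\}$, $\mathbb N_0=\mathbb N\cup\{0\}$, $p\in(\tfrac14,\tfrac13]$, $q=\sqrt{4p-1}$. $V\subset\mathbb R^2$ is the closed filled-in rhombus (closed convex hull) with vertices $P_\pm=(\pm\tfrac12,0)$ and $Q_\pm=(0,\pm\tfrac12 q)$. Maps: for $(a,b)\in A=\{0,1,2,3\}\times\{0,1\}$ the affine maps $\phi_{(a,b)}$ (which map $V$ into $V$) are $\phi_{(0,0)}(x,y)=\phi_{(0,1)}(x,y)=(px-\tfrac{1-p}{2},\,py)$; $\phi_{(3,0)}(x,y)=\phi_{(3,1)}(x,y)=(px+\tfrac{1-p}{2},\,py)$; $\phi_{(1,0)}(x,y)=\big(\tfrac12((1-2p)x-qy)+\tfrac{2p-1}{4},\ \tfrac12(qx+(1-2p)y)+\tfrac q4\big)$; $\phi_{(2,0)}(x,y)=\big(\tfrac12((1-2p)x+qy)+\tfrac{1-2p}{4},\ \tfrac12(-qx+(1-2p)y)+\tfrac q4\big)$; $\phi_{(1,1)}(x,y)=\big(\tfrac12((1-2p)x+qy)+\tfrac{2p-1}{4},\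 \tfrac12(-qx+(1-2p)y)-\tfrac q4\big)$; $\phi_{(2,1)}(x,y)=\big(\tfrac12((1-2p)x-qy)+\tfrac{1-2p}{4},\ \tfrac12(qx+(1-2p)y)-\tfrac q4\big)$. Generalised $p$-Koch curves: an element $\mathbf s\in\mathds S=\prod_{k=0}^\infty\{0,1\}^{4^k}$ is written $\mathbf s=((s_k(0),s_k(1),\dots,s_k(4^k-1)))_{k=0}^\infty$ with $s_k(i)\in\{0,1\}$. For $\mathbf u=(u_k)_{k\in\mathbb N}\in\{0,1,2,3\}^{\mathbb N}$ put $\omega_1(\mathbf u,\mathbf s)=(u_1,s_0(0))$ and, for $k\ge2$, $\omega_k(\mathbf u,\mathbf s)=\big(u_k,\,s_{k-1}(\sum_{j=1}^{k-1}u_j4^{k-1-j})\big)\in A$; write $\omega(\mathbf u,\mathbf s)=(\omega_k(\mathbf u,\mathbf s))_{k\in\mathbb N}$. For $\omega\in A^{\mathbb N}$, $\pi(\omega)$ denotes the unique element of $\bigcap_{k\in\mathbb N}(\phi_{\omega_1}\circ\cdots\circ\phi_{\omega_k})(V)$. The generalised $p$-Koch curve associated with $\mathbf s$ is $\mathcal C(\mathbf s)=\{\pi(\omega(\mathbf u,\mathbf s)):\mathbf u\in\{0,1,2,3\}^{\mathbb N}\}$. Its parameterisation $\rho_{\mathbf s}:[0,1]\to\mathcal C(\mathbf s)$ is $\rho_{\mathbf s}(t)=\pi(\omega(\mathbf u,\mathbf s))$, where $\mathbf u=(u_k)_{k\in\mathbb N}\in\{0,1,2,3\}^{\mathbb N}$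 is any sequence with $t=\sum_{k\in\mathbb N}u_k4^{-k}$ (the value does not depend on the chosen base 4 expansion). Generalised $p$-Koch snowflakes: let $f_1(x,y)=\big(-\tfrac12x+\tfrac{\sqrt3}{2}y+\tfrac14,\ -\tfrac{\sqrt3}{2}x-\tfrac12y-\tfrac{\sqrt3}{4}\big)$ and $f_2(x,y)=\big(-\tfrac12x-\tfrac{\sqrt3}{2}y-\tfrac14,\ \tfrac{\sqrt3}{2}x-\tfrac12y-\tfrac{\sqrt3}{4}\big)$. For $\mathbf s,\mathbf t,\mathbf r\in\mathds S$, $\mathcal F(\mathbf s,\mathbf t,\mathbf r)=\mathcal C(\mathbf s)\cup f_1(\mathcal C(\mathbf t))\cup f_2(\mathcal C(\mathbf r))$. Its parameterisation $\gamma:[0,1]\to\mathcal F(\mathbf s,\mathbf t,\mathbf r)$ is $\gamma(t)=\rho_{\mathbf s}(1-3t)$ for $t\in[0,\tfrac13)$, $\gamma(t)=f_2(\rho_{\mathbf r}(2-3t))$ for $t\in[\tfrac13,\tfrac23)$, and $\gamma(t)=f_1(\rho_{\mathbf t}(3-3t))$ for $t\in[\tfrac23,1]$. *)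

(* Defs.v *)
From mathcomp Require Import all_boot all_order all_algebra.
From mathcomp Require Import all_classical all_reals all_analysis.
Set Implicit Arguments.
Unset Strict Implicit.
Unset Printing Implicit Defensive.
Import Order.TTheory GRing.Theory Num.Theory.
Import numFieldNormedType.Exports.
Local Open Scope classical_set_scope.
Local Open Scope ring_scope.

(* [R^o] rather than [R]: the factors must be modules over [R] for
   [convex_set] to apply; the topology is the product topology. *)
Notation plane R := (R^o * R^o)%type.

(* Families (s_k(0), ..., s_k(4^k - 1)) for k >= 0. *)
Definition koch_signs : Type := forall k : nat, (4 ^ k)%N.-tuple bool.

(* The alphabet {0,1,2,3} x {0,1}, with [false] for 0 and [true] for 1. *)
Definition letter : Type := ('I_4 * bool)%type.

Section Koch.
Context {R : realType}.

Definition kq (p : R) : R := Num.sqrt (4 * p - 1).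

Definition rhombus (p : R) : set (plane R) :=
  smallest [set B : set (plane R) | closed B /\ convex_set B]
    [set z | [\/ z = (1 / 2, 0), z = (- (1 / 2), 0),
                 z = (0, kq p / 2) | z = (0, - (kq p / 2))]].

Definition phi (p : R) (a : letter) (z : plane R) : plane R :=
  let q := kq p in
  let x : R := z.1 in
  let y : R := z.2 in
  match val a.1, a.2 with
  | 0%N, _ => (p * x - (1 - p) / 2, p * y)
  | 1%N, false => (((1 - 2 * p) * x - q * y) / 2 + (2 * p - 1) / 4,
                   (q * x + (1 - 2 * p) * y) / 2 + q / 4)
  | 2%N, false => (((1 - 2 * p) * x + q * y) / 2 + (1 - 2 * p) / 4,
                   (- q * x + (1 - 2 * p) * y) / 2 + q / 4)
  | 1%N, true => (((1 - 2 * p) * x + q * y) / 2 + (2 * p - 1) / 4,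
                  (- q * x + (1 - 2 * p) * y) / 2 - q / 4)
  | 2%N, true => (((1 - 2 * p) * x - q * y) / 2 + (1 - 2 * p) / 4,
                  (q * x + (1 - 2 * p) * y) / 2 - q / 4)
  | _, _ => (p * x + (1 - p) / 2, p * y)
  end.

Fixpoint phi_word (p : R) (w : nat -> letter) (n : nat) : plane R -> plane R :=
  if n is m.+1 then phi_word p w m \o phi p (w m) else id.

(* The intersection is a singleton for 1/4 < p <= 1/3; [get] picks its element. *)
Definition koch_pi (p : R) (w : nat -> letter) : plane R :=
  get (\bigcap_n (phi_word p w n.+1 @` rhombus p)).

(* Sequences are indexed from 0: [u k] is the digit u_{k+1} and [omega u s k]
   the letter omega_{k+1}, so the index into s_k is
   u_1 4^(k-1) + ... + u_k 4^0 (always smaller than 4^k). *)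
Definition omega (u : nat -> 'I_4) (s : koch_signs) (k : nat) : letter :=
  (u k, nth false (s k) (\sum_(j < k) u j * 4 ^ (k - j.+1))%N).

Definition koch_curve (p : R) (s : koch_signs) : set (plane R) :=
  range (fun u : nat -> 'I_4 => koch_pi p (omega u s)).

Definition base4_expansion (u : nat -> 'I_4) (t : R) : Prop :=
  series (fun k => (u k)%:R / 4 ^+ k.+1 : R) @ \oo --> t.

(* The set is a singleton for t in [0, 1], since the value does not depend on
   the expansion; outside [0, 1] it is empty and the value is irrelevant. *)
Definition rho (p : R) (s : koch_signs) (t : R) : plane R :=
  get [set koch_pi p (omega u s) | u in [set u | base4_expansion u t]].

Definition f1 (z : plane R) : plane R :=
  let x : R := z.1 in
  let y : R := z.2 in
  (- (1 / 2) * x + Num.sqrt 3 / 2 * y + 1 / 4,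
   - (Num.sqrt 3 / 2) * x - 1 / 2 * y - Num.sqrt 3 / 4).

Definition f2 (z : plane R) : plane R :=
  let x : R := z.1 in
  let y : R := z.2 in
  (- (1 / 2) * x - Num.sqrt 3 / 2 * y - 1 / 4,
   Num.sqrt 3 / 2 * x - 1 / 2 * y - Num.sqrt 3 / 4).

Definition snowflake (p : R) (s t r : koch_signs) : set (plane R) :=
  koch_curve p s `|` f1 @` koch_curve p t `|` f2 @` koch_curve p r.

(* Only meaningful on [0, 1]. *)
Definition gamma (p : R) (s t r : koch_signs) (x : R) : plane R :=
  if x < 1 / 3 then rho p s (1 - 3 * x)
  else if x < 2 / 3 then f2 (rho p r (2 - 3 * x))
  else f1 (rho p t (3 - 3 * x)).

Definition unit_circle : set (plane R) :=
  [set z | (z.1 : R) ^+ 2 + (z.2 : R) ^+ 2 = 1].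

End Koch.

(* [A] and [B] are homeomorphic for their subspace topologies. *)
Definition homeomorphic (T U : topologicalType) (A : set T) (B : set U) : Prop :=
  exists (f : T -> U) (g : U -> T),
    [/\ {within A, continuous f}, {within B, continuous g},
        f @` A `<=` B, g @` B `<=` A &
        {in A, cancel f g} /\ {in B, cancel g f}].

Definition jordan_curve (R : realType) (F : set (plane R)) : Prop :=
  homeomorphic (@unit_circle R) F.

(* Main.v *)
Require Import Defs.
From mathcomp Require Import all_boot all_order all_algebra.
From mathcomp Require Import all_classical all_reals all_analysis.
From mathcomp Require Import ring lra.
Set Implicit Arguments.
Unset Strict Implicit.
Unset Printing Implicit Defensive.
Import Order.TTheory GRing.Theory Num.Theory.
Import numFieldNormedType.Exports.
Local Open Scope classical_set_scope.
Local Open Scope ring_scope.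

(** The snowflake is the image of a loop, and an injective loop is a Jordan
    curve because a continuous map from a compact space to a Hausdorff space is
    a quotient map onto its image. Both [t |-> (cos (2 pi t), sin (2 pi t))] and
    [gamma] identify the end points of [[0, 1]] and nothing else, so each of
    them factors continuously through the other ([same_fibres_homeomorphic],
    [loop_jordan]).

    It remains to see that [gamma] is a continuous loop onto the snowflake, and
    that it is injective for [p < 1 / 3]. All of this follows from one functional
    equation ([koch_param_quarter]): on the [a]-th quarter of [[0, 1]], the
    parameterisation of a generalised Koch curve is the image under the similarity
    [phi p (a, b)] of that of another generalised Koch curve. For the equation to
    be closed under iteration, the signs are allowed to be arbitrary arrays, of
    which the four parts are again arrays. That the parameterisation does not
    depend on the base 4 expansion ([koch_point_indep]), and its uniform
    continuity ([koch_param_modulus]), are then inductions in which every level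
    gains the contraction factor of the similarities; consecutive cells fit
    together since the end of one is the start of the next ([phi_join]).
    Distances are measured by the squared Euclidean distance, which a similarity
    of ratio [p] multiplies by exactly [p ^ 2].

    For [p < 1 / 3], the four first level cells lie in consecutive vertical strips
    and touch the boundaries of the strips only at the two ends of the curve in
    the cell ([phi_x_lt_right], [phi_x_gt_left]). Hence two distinct parameters
    with the same image could be moved apart by the factor 4 over and over
    ([koch_param_inj]). Finally, the three rhombi of the snowflake lie in the
    three sectors in which the rays from the centre of the triangle to its
    vertices cut the plane, and they meet these rays only at the vertices
    ([rhombus_f1_meet], [rhombus_f2_meet]). *)

(** * Squared distance in the plane *)

Section PlaneMetric.
Context {R : realType}.
Implicit Types z w v : plane R.

Definition sqdist z w : R := (z.1 - w.1) ^+ 2 + (z.2 - w.2) ^+ 2.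

Lemma sqdist_ge0 z w : 0 <= sqdist z w.
Proof. by rewrite addr_ge0 ?sqr_ge0. Qed.

Lemma sqdistzz z : sqdist z z = 0.
Proof. by rewrite /sqdist !subrr expr0n addr0. Qed.

Lemma sqdistC z w : sqdist z w = sqdist w z.
Proof. by rewrite /sqdist -[z.1 - _]opprB -[z.2 - _]opprB !sqrrN. Qed.

Lemma sqdist_eq0 z w : sqdist z w = 0 -> z = w.
Proof.
case: z w => [x y] [x' y'] /eqP; rewrite /sqdist /=.
by rewrite paddr_eq0 ?sqr_ge0// !sqrf_eq0 !subr_eq0 => /andP[/eqP -> /eqP ->].
Qed.

Lemma sqdist_triangle v z w : sqdist z w <= 2 * (sqdist z v + sqdist v w).
Proof.
rewrite /sqdist; case: z w v => [x y] [x' y'] [x'' y''] /=.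
have hx := sqr_ge0 ((x - x'') - (x'' - x')).
have hy := sqr_ge0 ((y - y'') - (y'' - y')).
move: hx hy; rewrite !expr2 => hx hy; lra.
Qed.

Lemma sqdist_lt_ball z w (e : R) : 0 < e -> sqdist z w < e ^+ 2 -> ball z e w.
Proof.
rewrite /sqdist => e0 zw; split; rewrite -ball_normE /=;
  rewrite -(@ltr_pXn2r _ 2)// ?nnegrE ?(ltW e0)// real_normK ?num_real//;
  apply: le_lt_trans zw.
- by rewrite lerDl sqr_ge0.
- by rewrite lerDr sqr_ge0.
Qed.

Lemma near_sqdist_lt z (e : R) : 0 < e -> \forall w \near z, sqdist z w < e.
Proof.
(* Coordinates below 1 in absolute value bound their squares. *)
move=> e0; have d0 : 0 < Num.min 1 (e / 2) by rewrite lt_min ltr01 divr_gt0.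
near=> w.
have : ball z (Num.min 1 (e / 2)) w by near: w; exact: nbhsx_ballx.
rewrite /sqdist => -[]; rewrite -!ball_normE /= !lt_min => /andP[a1 a2] /andP[b1 b2].
have sq (a : R) : `|a| < 1 -> `|a| < e / 2 -> a ^+ 2 < e / 2.
  move=> h1 h2; rewrite -(real_normK (num_real a)) expr2.
  by apply: le_lt_trans h2; rewrite ler_piMl// ltW.
by have := sq _ a1 a2; have := sq _ b1 b2; lra.
Unshelve. all: by end_near. Qed.

Lemma sqdist_nonexpansive_continuous (f : plane R -> plane R) :
  (forall z w, sqdist (f z) (f w) <= sqdist z w) -> continuous f.
Proof.
move=> fle z; apply/cvgrPdist_lt => /= e e0.
have e20 : 0 < e ^+ 2 by rewrite exprn_gt0.
near=> w.
have : ball (f z) e (f w).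
  apply: sqdist_lt_ball => //; apply: le_lt_trans (fle _ _) _.
  by near: w; exact: near_sqdist_lt.
by rewrite -ball_normE.
Unshelve. all: by end_near. Qed.

(** The hypothesis is a modulus of continuity along the scales [4 ^- n], the
    natural ones for a curve parameterised by base 4 digits. *)
Lemma continuous_geometric_modulus (g : R -> plane R) (C a : R) :
  0 <= a < 1 ->
  (forall n t t', `|t - t'| <= 4 ^- n -> sqdist (g t) (g t') <= C * a ^+ n) ->
  continuous g.
Proof.
move=> /andP[a0 a1] gmod t; apply/cvgrPdist_lt => /= e e0.
have e20 : 0 < e ^+ 2 by rewrite exprn_gt0.
have Ca0 : (fun n => C * a ^+ n) @ \oo --> C * 0.
  by apply: cvgM; [exact: cvg_cst|apply: cvg_expr; rewrite ger0_norm].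
move/cvgrPdist_lt: Ca0 => /(_ _ e20) [N _ /(_ N (leqnn _))] /=.
rewrite mulr0 sub0r normrN => hN.
near=> t'.
suff : ball (g t) e (g t') by rewrite -ball_normE.
apply: sqdist_lt_ball => //; apply: le_lt_trans (gmod N _ _ _) _; last first.
  exact: le_lt_trans (ler_norm _) hN.
by near: t'; apply: cvgr_dist_le; rewrite // invr_gt0 exprn_gt0.
Unshelve. all: by end_near. Qed.

Lemma geometric_le0 (x C a : R) :
  0 <= a < 1 -> (forall n, x <= C * a ^+ n) -> x <= 0.
Proof.
move=> /andP[a0 a1] xle.
have Ca0 : (fun n => C * a ^+ n) @ \oo --> C * 0.
  by apply: cvgM; [exact: cvg_cst|apply: cvg_expr; rewrite ger0_norm].
have := cvg_lim (@Rhausdorff R) Ca0; rewrite mulr0 => <-.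
by apply: limr_ge; [apply/cvg_ex; exists (C * 0)|apply: nearW].
Qed.

Lemma sqdist_geometric_eq (z w : plane R) (C a : R) :
  0 <= a < 1 -> (forall n, sqdist z w <= C * a ^+ n) -> z = w.
Proof.
move=> a01 zw; apply: sqdist_eq0; apply/eqP.
by rewrite eq_le sqdist_ge0 (geometric_le0 a01 zw).
Qed.

End PlaneMetric.

(** * The rhombus and the similarities *)

Section Rhombus.
Context {R : realType} (p : R).
Context (p_gt : 1 / 4 < p) (p_le : p <= 1 / 3).
Notation q := (kq p).

Lemma kq_gt0 : 0 < q.
Proof. by have pg := p_gt; rewrite sqrtr_gt0; lra. Qed.

Lemma kq_sqr : q ^+ 2 = 4 * p - 1.
Proof. by have pg := p_gt; rewrite sqr_sqrtr//; lra. Qed.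

(** The inequality form of [|x| + |y| / q <= 1 / 2], split over the four signs
    so that linear arithmetic applies. *)
Definition diamond : set (plane R) :=
  [set z | [/\ q * z.1 + z.2 <= q / 2, q * z.1 - z.2 <= q / 2,
               - (q * z.1) + z.2 <= q / 2 & - (q * z.1) - z.2 <= q / 2]].

Lemma diamond_closed : closed diamond.
Proof.
have -> : diamond = [set z : plane R | q * `|z.1 : R| + `|z.2 : R| <= q / 2].
  have q0 := kq_gt0; apply/seteqP; split => -[x y] /=.
    move=> [/= h1 h2 h3 h4]; rewrite -{1}(ger0_norm (ltW q0)) -normrM.
    by case: (ger0P (q * x)) => ?; case: (ger0P y) => ?; lra.
  rewrite -{1}(ger0_norm (ltW q0)) -normrM => h.
  have := ler_norm (q * x); have := ler_norm (- (q * x)).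
  have := ler_norm y; have := ler_norm (- y); rewrite !normrN => *.
  by split => /=; lra.
apply: (@closed_comp _ _ (fun z : plane R => q * `|z.1 : R| + `|z.2 : R| : R)
  [set r | r <= q / 2]); last exact: closed_le.
move=> z _; apply: cvgD.
  apply: cvgM; first exact: cvg_cst.
  by apply: cvg_norm; exact: cvg_fst.
by apply: cvg_norm; exact: cvg_snd.
Qed.

Lemma convE_plane (l : {i01 R}) (z w : plane R) :
  conv l (z : convex_lmodType (plane R)) w =
  (l%:num * (z.1 : R) + (1 - l%:num) * (w.1 : R),
   l%:num * (z.2 : R) + (1 - l%:num) * (w.2 : R)) :> plane R.
Proof. by []. Qed.

Lemma diamond_convex : convex_set diamond.
Proof.
move=> [x y] [x' y'] l; rewrite !inE convE_plane /diamond /=.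
have l0 : 0 <= l%:num by []. have l1 : 0 <= 1 - l%:num by rewrite subr_ge0.
move: (l%:num) l0 l1 => {}l l0 l1.
move=> [/= h1 h2 h3 h4] [/= h1' h2' h3' h4']; split.
- by have := lerD (ler_wpM2l l0 h1) (ler_wpM2l l1 h1'); lra.
- by have := lerD (ler_wpM2l l0 h2) (ler_wpM2l l1 h2'); lra.
- by have := lerD (ler_wpM2l l0 h3) (ler_wpM2l l1 h3'); lra.
- by have := lerD (ler_wpM2l l0 h4) (ler_wpM2l l1 h4'); lra.
Qed.

Lemma convex_segment (B : set (plane R)) (z w : plane R) (l : R) :
  convex_set B -> B z -> B w -> 0 <= l <= 1 ->
  B (l * (z.1 : R) + (1 - l) * (w.1 : R), l * (z.2 : R) + (1 - l) * (w.2 : R)).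
Proof.
move=> Bc Bz Bw /andP[l0 l1].
have := Bc z w (Itv01 l0 l1); rewrite !inE convE_plane; exact.
Qed.

(** The diamond is closed and convex, so it contains the hull; conversely each of
    its points is a convex combination of three vertices. *)
Lemma rhombusE : rhombus p = diamond.
Proof.
have q0 := kq_gt0; apply/seteqP; split.
  apply: smallest_sub; first by split; [exact: diamond_closed|exact: diamond_convex].
  by move=> z /=; rewrite /diamond/= => -[] ->/=; split; lra.
move=> [x y] hz B [[_ Bc] Bv].
(* The horizontal diagonal, then the segment from its point below or above
   [(x, y)] to the nearer of the two other vertices. *)
have Bx (a : R) : `|a| <= 1 / 2 -> B (a, 0).
  rewrite ler_norml => /andP[a1 a2].
  have := @convex_segment B (1 / 2, 0) (- (1 / 2), 0) (a + 1 / 2) Bc.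
  set l := a + _; move=> /(_ _ _ _)/=.
  rewrite !mulr0 addr0; have -> : l * (1 / 2) + (1 - l) * - (1 / 2) = a by rewrite /l; lra.
  apply; [by apply: Bv; constructor 1|by apply: Bv; constructor 2|by rewrite /l; lra].
have By (sg : R) : (sg == 1) || (sg == -1) -> 0 <= sg * y -> B (x, y).
  move=> sg1 sgy.
  have sg2 : sg * sg = 1 by case/orP: sg1 => /eqP ->; lra.
  have Bq : B (0, sg * (q / 2)).
    apply: Bv; case/orP: sg1 => /eqP ->; rewrite ?mul1r ?mulN1r /=;
      [by constructor 3|by constructor 4].
  pose l := (sg * y) / (q / 2).
  have lE : l * (q / 2) = sg * y by rewrite /l divfK//; lra.
  have l0 : 0 <= l by rewrite /l divr_ge0//; lra.
  have hxy : q * `|x| + sg * y <= q / 2.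
    case: hz => /= h1 h2 h3 h4.
    by case/orP: sg1 => /eqP ->; case: (ger0P x) => hx; lra.
  have hxl : `|x| <= (1 - l) / 2.
    rewrite -(ler_pM2l q0); lra.
  have l1 : l <= 1 by have := normr_ge0 x; lra.
  have [l1E|l1N] := eqVneq l 1.
    have -> : x = 0 by apply/eqP; rewrite -normr_le0; rewrite l1E in hxl; lra.
    suff -> : y = sg * (q / 2) by [].
    by have := lE; rewrite l1E mul1r => ->; rewrite mulrA sg2 mul1r.
  have l1' : 0 < 1 - l by rewrite subr_gt0 lt_neqAle l1N.
  have Ba : B (x / (1 - l), 0).
    apply: Bx; rewrite normrM normfV (gtr0_norm l1') ler_pdivrMr//; lra.
  have := convex_segment Bc Bq Ba; move=> /(_ l)/=; rewrite l0 l1 => /(_ isT).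
  rewrite !mulr0 add0r addr0 [(1 - l) * _]mulrC divfK ?gt_eqF//.
  by rewrite mulrCA lE mulrA sg2 mul1r.
have [y0|y0] := lerP 0 y.
  by apply: (By 1); rewrite ?eqxx ?mul1r.
by apply: (By (-1)); rewrite ?eqxx ?orbT ?mulN1r ?oppr_ge0 ?ltW.
Qed.

Lemma rhombus_closed : closed (rhombus p).
Proof. by rewrite rhombusE; exact: diamond_closed. Qed.

Lemma rhombus_le z : rhombus p z -> `|z.1 : R| <= 1 / 2 /\ `|z.2 : R| <= 1 / 2.
Proof.
rewrite rhombusE; case: z => x y [/=] h1 h2 h3 h4.
have pl := p_le; have q0 := kq_gt0; have q1 : q <= 1 by rewrite -sqrtr1 ler_wsqrtr//; lra.
split; last by rewrite ler_norml; lra.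
rewrite -(ler_pM2l q0) -{1}(gtr0_norm q0) -normrM ler_norml; lra.
Qed.

Lemma sqdist_rhombus z w : rhombus p z -> rhombus p w -> sqdist z w <= 2.
Proof.
move=> /rhombus_le[]; rewrite !ler_norml => /andP[? ?] /andP[? ?].
move=> /rhombus_le[]; rewrite !ler_norml => /andP[? ?] /andP[? ?].
have sq (a : R) : -1 <= a <= 1 -> a ^+ 2 <= 1.
  move=> /andP[? ?]; have : 0 <= (1 - a) * (1 + a) by rewrite mulr_ge0; lra.
  rewrite expr2; lra.
rewrite /sqdist; have -> : (2 : R) = 1 + 1 by lra.
by apply: lerD; apply: sq; lra.
Qed.

Lemma rhombus_compact : compact (rhombus p).
Proof.
apply: (@subclosed_compact _ _ (`[-(1/2), 1/2] `*` `[-(1/2), 1/2] : set (plane R))).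
- exact: rhombus_closed.
- by apply: compact_setX; exact: segment_compact.
- by move=> z /rhombus_le[]; rewrite !ler_norml; split; rewrite /= in_itv.
Qed.

Definition kP_left : plane R := (- (1 / 2), 0).
Definition kP_right : plane R := (1 / 2, 0).

Lemma rhombus_left : rhombus p kP_left.
Proof. by have q0 := kq_gt0; rewrite rhombusE; split => /=; lra. Qed.

Lemma rhombus_right : rhombus p kP_right.
Proof. by have q0 := kq_gt0; rewrite rhombusE; split => /=; lra. Qed.

(** The inclined similarities have ratio [p] because
    [(1 - 2 * p) ^ 2 + q ^ 2 = (2 * p) ^ 2]. *)
Lemma phi_sqdist a z w : sqdist (phi p a z) (phi p a w) = p ^+ 2 * sqdist z w.
Proof.
case: z w => [x y] [x' y']; rewrite /sqdist /phi.
have : q ^+ 2 * ((x - x') ^+ 2 + (y - y') ^+ 2) =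
  (4 * p - 1) * ((x - x') ^+ 2 + (y - y') ^+ 2) by rewrite kq_sqr.
by case: a => [[[|[|[|[|//]]]] ?] []] /=; lra.
Qed.

Lemma phi_rhombus a z : rhombus p z -> rhombus p (phi p a z).
Proof.
rewrite rhombusE; case: z => x y [/=] h1 h2 h3 h4; rewrite /diamond /phi.
have pg := p_gt; have pl := p_le; have q0 := kq_gt0.
have p0 : 0 <= p by lra.
have p2 : 0 <= 1 - 2 * p by lra.
have pq := mulr_ge0 p0 (ltW q0).
have pq2 := mulr_ge0 p2 (ltW q0).
(* Up to constants, an edge form of the rhombus composed with an inclined similarity is
   a combination of edge forms with coefficients [p] and [1 - 2 * p]. *)
have e1 : q ^+ 2 * x = (4 * p - 1) * x by rewrite kq_sqr.
have e2 : q ^+ 2 * y = (4 * p - 1) * y by rewrite kq_sqr.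
move: (ler_wpM2l p0 h1) (ler_wpM2l p0 h2) (ler_wpM2l p0 h3) (ler_wpM2l p0 h4).
move: (ler_wpM2l p2 h1) (ler_wpM2l p2 h2) (ler_wpM2l p2 h3) (ler_wpM2l p2 h4).
move=> {h1 h2 h3 h4} *.
by case: a => [[[|[|[|[|//]]]] ?] []] /=; split; lra.
Qed.

End Rhombus.

(** * Coding of the points of a curve *)

Section Coding.
Context {R : realType} (p : R).
Context (p_gt : 1 / 4 < p) (p_le : p <= 1 / 3).
Notation V := (rhombus p).
Notation wshift w := (fun k : nat => w k.+1).

Lemma ratio_bounds : 0 <= p ^+ 2 < 1.
Proof.
have pg := p_gt; have pl := p_le.
by rewrite sqr_ge0 expr_lt1//; lra.
Qed.

Lemma phi_continuous a : continuous (phi p a).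
Proof.
apply: sqdist_nonexpansive_continuous => z w.
rewrite phi_sqdist// ler_piMl ?sqdist_ge0//.
by have /andP[_ /ltW] := ratio_bounds.
Qed.

Lemma phi_word_continuous w n : continuous (phi_word p w n).
Proof.
elim: n => [|n IHn] z /=; first exact: cvg_id.
by apply: continuous_comp; [exact: phi_continuous|exact: IHn].
Qed.

Lemma phi_wordS w n z :
  phi_word p w n.+1 z = phi p (w 0%N) (phi_word p (wshift w) n z).
Proof. by elim: n z => [//|n IHn] z; rewrite /= -IHn. Qed.

Lemma phi_word_rhombusS w n :
  phi_word p w n.+1 @` V `<=` phi_word p w n @` V.
Proof. by move=> _ [z Vz <-]; exists (phi p (w n) z) => //; exact: phi_rhombus. Qed.

Lemma phi_word_rhombus_decr w m n : (m <= n)%N ->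
  phi_word p w n @` V `<=` phi_word p w m @` V.
Proof.
move=> /subnK <-; elim: (n - m)%N => [//|k IHk].
exact: subset_trans (@phi_word_rhombusS w (k + m)) IHk.
Qed.

Lemma phi_word_sqdist w n z v :
  sqdist (phi_word p w n z) (phi_word p w n v) = (p ^+ 2) ^+ n * sqdist z v.
Proof.
elim: n z v => [|n IHn] z v; first by rewrite expr0 mul1r.
by rewrite /= IHn phi_sqdist// [(p ^+ 2) ^+ n.+1]exprSr mulrA.
Qed.

Lemma phi_word_unique w z v :
  (forall n, (phi_word p w n @` V) z) -> (forall n, (phi_word p w n @` V) v) ->
  z = v.
Proof.
move=> hz hv; apply: (@sqdist_geometric_eq _ _ _ 2 _ ratio_bounds) => n.
have [z' Vz' <-] := hz n; have [v' Vv' <-] := hv n.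
rewrite phi_word_sqdist [leRHS]mulrC ler_wpM2l ?(exprn_ge0 n (sqr_ge0 p))//.
exact: (sqdist_rhombus p_gt p_le).
Qed.

(** The cells are nested compact sets: any cluster point of a sequence that
    enters them all belongs to each of them. *)
Lemma koch_pi_in w n : (phi_word p w n @` V) (koch_pi p w).
Proof.
suff : (\bigcap_n (phi_word p w n.+1 @` V)) (koch_pi p w).
  by move=> /(_ n I); exact: phi_word_rhombusS.
apply: getPex.
pose F := (fun n => phi_word p w n kP_left) @ \oo.
have FV m : F (phi_word p w m @` V).
  exists m => // k /= mk; apply: (phi_word_rhombus_decr mk).
  by exists kP_left => //; exact: rhombus_left.
have [|z [_ Fz]] := @rhombus_compact _ _ p_gt p_le F _.
  by have := FV 0%N; apply: filterS => _ [z Vz <-].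
exists z => k _.
have : closed (phi_word p w k.+1 @` V).
  apply: compact_closed; first exact: norm_hausdorff.
  apply: continuous_compact; last exact: rhombus_compact.
  exact/continuous_subspaceT/phi_word_continuous.
by apply => B Bz; exact: Fz (FV _) Bz.
Qed.

Lemma koch_pi_rhombus w : V (koch_pi p w).
Proof. by have [z Vz <-] := koch_pi_in w 0. Qed.

Lemma koch_piS w : koch_pi p w = phi p (w 0%N) (koch_pi p (wshift w)).
Proof.
apply: (@phi_word_unique w) => n; first exact: koch_pi_in.
apply: (phi_word_rhombus_decr (leqnSn n)).
have [z Vz <-] := koch_pi_in (wshift w) n.
by exists z => //; rewrite phi_wordS.
Qed.

(** Arrays of signs indexed by all of [nat * nat]: the four parts of such an
    array are again arrays, without any bookkeeping of sizes. *)
Definition signs_of (s : koch_signs) (k i : nat) : bool := nth false (s k) i.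

Definition sub_signs (S : nat -> nat -> bool) (a k i : nat) : bool :=
  S k.+1 (a * 4 ^ k + i)%N.

Definition address (u : nat -> 'I_4) (S : nat -> nat -> bool) (k : nat) : letter :=
  (u k, S k (\sum_(j < k) u j * 4 ^ (k - j.+1))%N).

(** The index of a sign is the integer whose base 4 digits are the previous letters;
    dropping the first letter removes its leading digit. *)
Lemma addressS u S :
  wshift (address u S) = address (wshift u) (sub_signs S (u 0%N)).
Proof.
apply/funext => k; rewrite /address /sub_signs big_ord_recl/= subn1/=.
by congr (_, S _ (_ + _)%N); apply: eq_bigr => j _; rewrite /bump/= add1n subSS.
Qed.

Definition koch_point S u : plane R := koch_pi p (address u S).

Lemma koch_pointE S u :
  koch_point S u =
  phi p (u 0%N, S 0%N 0%N) (koch_point (sub_signs S (u 0%N)) (wshift u)).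
Proof. by rewrite /koch_point koch_piS addressS /address big_ord0. Qed.

End Coding.

Section Base4.
Context {R : realType}.
Implicit Types (u : nat -> 'I_4) (t : R).
Notation wshift w := (fun k : nat => w k.+1).
Notation psum u := (series (fun k => (u k)%:R / 4 ^+ k.+1 : R)).

Lemma base4_sumS u n :
  psum u n.+1 = (u 0%N)%:R / 4 + psum (wshift u) n / 4.
Proof.
rewrite /series /= big_nat_recl// expr1; congr (_ + _).
by rewrite big_distrl/=; apply: eq_bigr => i _; rewrite [4 ^+ i.+2]exprSr invfM mulrA.
Qed.

Lemma base4_expansionS u t :
  base4_expansion (wshift u) (4 * t - (u 0%N)%:R) <-> base4_expansion u t.
Proof.
rewrite /base4_expansion; split => h.
  rewrite -cvg_shiftS.
  have -> : t = (u 0%N)%:R / 4 + (4 * t - (u 0%N)%:R) / 4 by lra.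
  under eq_fun do rewrite base4_sumS.
  by apply: cvgD; [exact: cvg_cst|apply: cvgMl].
have {}h : (fun n => psum u n.+1) @ \oo --> t by rewrite cvg_shiftS.
have -> : psum (wshift u) = (fun n => 4 * psum u n.+1 - (u 0%N)%:R).
  by apply/funext => n; rewrite base4_sumS; lra.
by apply: cvgB; [apply: cvgMr|exact: cvg_cst].
Qed.

Lemma ord4_le3 (a : 'I_4) : 0 <= (a%:R : R) <= 3.
Proof. by rewrite ler0n (ler_nat R a 3) -ltnS ltn_ord. Qed.

Lemma base4_sum_itv u n : 0 <= psum u n <= 1.
Proof.
elim: n u => [|n IHn] u; first by rewrite /series/= big_geq// lexx ler01.
by rewrite base4_sumS; have := IHn (wshift u); have := ord4_le3 (u 0%N); lra.
Qed.

Lemma base4_expansion_itv u t : base4_expansion u t -> 0 <= t <= 1.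
Proof.
move=> ut; have ul := cvg_lim (@Rhausdorff R) ut.
have uc : cvgn (psum u) by apply/cvg_ex; exists t.
by rewrite -ul; apply/andP; split; [apply: limr_ge|apply: limr_le] => //;
  apply: nearW => n; have /andP[] := base4_sum_itv u n.
Qed.

Lemma quarter_cover t : 0 <= t <= 1 -> exists a : 'I_4, 0 <= 4 * t - a%:R <= 1.
Proof.
move=> t01.
have [h|h] := lerP (4 * t) 1; first by exists (Ordinal (isT : (0 < 4)%N)) => /=; lra.
have [h2|h2] := lerP (4 * t) 2; first by exists (Ordinal (isT : (1 < 4)%N)) => /=; lra.
have [h3|h3] := lerP (4 * t) 3; first by exists (Ordinal (isT : (2 < 4)%N)) => /=; lra.
by exists (Ordinal (isT : (3 < 4)%N)) => /=; lra.
Qed.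

(** The digits come from the expanding map [x |-> 4 * x - d x], where [d x] is the
    index of a quarter that contains [x]; its orbit stays in [[0, 1]] and is the
    rescaled remainder of the partial sums. *)
Lemma base4_expansion_ex t : 0 <= t <= 1 -> exists u, base4_expansion u t.
Proof.
move=> t01.
have [d dP] : exists d : R -> 'I_4,
    forall x : R, 0 <= x <= 1 -> 0 <= 4 * x - (d x)%:R <= 1.
  have /choice[d dP] : forall x : R, exists a : 'I_4,
      0 <= x <= 1 -> 0 <= 4 * x - a%:R <= 1.
    move=> x; have [/quarter_cover[a ha]|nx] := boolP (0 <= x <= 1).
      by exists a.
    by exists ord0.
  by exists d.
pose T n : R := iter n (fun x : R => 4 * x - (d x)%:R) t.
have T01 n : 0 <= T n <= 1 by elim: n => [//|n IHn]; exact: dP.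
pose u n := d (T n); exists u.
have tE n : t - psum u n = T n / 4 ^+ n.
  elim: n => [|n IHn]; first by rewrite /series/= big_geq// expr0 subr0 divr1.
  rewrite seriesSr opprD addrA IHn /= -/(T n) /u exprS invfM.
  have : (4 ^+ n : R) != 0 by rewrite expf_neq0//; lra.
  by move=> h; field.
apply/cvgrPdist_lt => e e0.
have V0 : (fun n => (4^-1 : R) ^+ n) @ \oo --> (0 : R).
  by apply: cvg_expr; rewrite ger0_norm; lra.
move/cvgrPdist_lt : V0 => /(_ _ e0); apply: filterS => n /=.
rewrite sub0r normrN tE exprVn; apply: le_lt_trans.
have /andP[T0 T1] := T01 n.
by rewrite normrM (ger0_norm T0) ler_piMl.
Qed.

End Base4.

(** * Parameterisation of the curves *)

Section Curve.
Context {R : realType} (p : R).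
Context (p_gt : 1 / 4 < p) (p_le : p <= 1 / 3).
Notation V := (rhombus p).
Notation wshift w := (fun k : nat => w k.+1).
Notation ratio01 := (ratio_bounds p_gt p_le).

Lemma phi_fix_left (a : 'I_4) b : a = 0%N :> nat -> phi p (a, b) kP_left = kP_left.
Proof.
by case: a => [[|//] ?] _; rewrite /phi/=; congr pair; lra.
Qed.

Lemma phi_fix_right (a : 'I_4) b : a = 3%N :> nat -> phi p (a, b) kP_right = kP_right.
Proof.
by case: a => [[|[|[|[|//]]]] ?]//= _; rewrite /phi/=; congr pair; lra.
Qed.

Lemma phi_join (a a' : 'I_4) b : a' = a.+1 :> nat ->
  phi p (a, b) kP_right = phi p (a', b) kP_left.
Proof.
by case: a a' => [[|[|[|[|//]]]] ?] [[|[|[|[|//]]]] ?] //= _;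
  case: b; rewrite /phi/=; congr pair; lra.
Qed.

Lemma koch_point_rhombus S u : V (koch_point p S u).
Proof. exact: koch_pi_rhombus. Qed.

Lemma sqdist_phi_le a z v n C : sqdist z v <= C * (p ^+ 2) ^+ n ->
  sqdist (phi p a z) (phi p a v) <= C * (p ^+ 2) ^+ n.+1.
Proof.
by move=> h; rewrite phi_sqdist// [(p ^+ 2) ^+ n.+1]exprS mulrCA ler_wpM2l ?sqr_ge0.
Qed.

(** All digits of an expansion of 0 are 0, and the similarities of this letter fix
    [kP_left]. *)
Lemma koch_point_left S u : base4_expansion u (0 : R) -> koch_point p S u = kP_left.
Proof.
move=> u0; apply: (@sqdist_geometric_eq _ _ _ 2 _ ratio01) => n.
elim: n S u u0 => [|n IHn] S u u0.
  by rewrite expr0 mulr1 (sqdist_rhombus p_gt p_le)//;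
    [exact: koch_point_rhombus|exact: rhombus_left].
move/base4_expansionS: u0 => u0.
have u0E : u 0%N = 0%N :> nat.
  have := base4_expansion_itv u0.
  by rewrite mulr0 sub0r oppr_ge0 lern0 => /andP[/eqP].
rewrite koch_pointE// -(phi_fix_left (S 0%N 0%N) u0E).
apply: sqdist_phi_le; apply: IHn.
by move: u0; rewrite u0E mulr0 subr0.
Qed.

Lemma koch_point_right S u : base4_expansion u (1 : R) -> koch_point p S u = kP_right.
Proof.
move=> u1; apply: (@sqdist_geometric_eq _ _ _ 2 _ ratio01) => n.
elim: n S u u1 => [|n IHn] S u u1.
  by rewrite expr0 mulr1 (sqdist_rhombus p_gt p_le)//;
    [exact: koch_point_rhombus|exact: rhombus_right].
move/base4_expansionS: u1 => u1.
have u0E : u 0%N = 3%N :> nat.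
  have := base4_expansion_itv u1; rewrite mulr1 => /andP[_ h].
  have : (3%:R : R) <= (u 0%N)%:R by lra.
  by rewrite ler_nat; case: (u 0%N) => [[|[|[|[|]]]]].
rewrite koch_pointE// -(phi_fix_right (S 0%N 0%N) u0E).
apply: sqdist_phi_le; apply: IHn.
move: u1; rewrite u0E mulr1; have -> : 4 - 3%:R = 1 :> R by lra.
exact.
Qed.

(** Two expansions of one number agree up to a digit where one of them goes on
    with 0s and the other with 3s; the signs in these tails are irrelevant, as
    the two ends of the rhombus are fixed by the letters 0 and 3 whatever the
    sign. *)
Lemma koch_point_indep S u v (t : R) :
  base4_expansion u t -> base4_expansion v t -> koch_point p S u = koch_point p S v.
Proof.
move=> ut vt; apply: (@sqdist_geometric_eq _ _ _ 2 _ ratio01) => n.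
elim: n S u v t ut vt => [|n IHn] S u v t ut vt.
  rewrite expr0 mulr1 (sqdist_rhombus p_gt p_le)//; exact: koch_point_rhombus.
have next (u' v' : nat -> 'I_4) : base4_expansion u' t -> base4_expansion v' t ->
    (u' 0%N < v' 0%N)%N -> koch_point p S u' = koch_point p S v'.
  move=> /base4_expansionS ut' /base4_expansionS vt' uv.
  have vu : v' 0%N = (u' 0%N).+1 :> nat.
    apply/eqP; rewrite eqn_leq uv andbT -(ler_nat R) -natr1.
    by have := base4_expansion_itv ut'; have := base4_expansion_itv vt'; lra.
  have tE : 4 * t = (v' 0%N)%:R.
    have : ((v' 0%N)%:R : R) = (u' 0%N)%:R + 1 by rewrite vu -natr1.
    by have := base4_expansion_itv ut'; have := base4_expansion_itv vt'; lra.
  move: vt'; rewrite tE subrr => vt'.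
  move: ut'; rewrite tE vu -natr1 addrAC subrr add0r => ut'.
  rewrite [LHS]koch_pointE// [RHS]koch_pointE//.
  rewrite (koch_point_left _ vt') (koch_point_right _ ut').
  exact: phi_join.
case: (ltngtP (u 0%N) (v 0%N)) => [uv|vu|uv].
- by rewrite (next u v)// sqdistzz mulr_ge0// exprn_ge0// sqr_ge0.
- by rewrite (next v u)// sqdistzz mulr_ge0// exprn_ge0// sqr_ge0.
move/val_inj: uv => uv.
rewrite [X in sqdist X _]koch_pointE// [X in sqdist _ X]koch_pointE// -uv; apply: sqdist_phi_le.
apply: (IHn _ _ _ (4 * t - (u 0%N)%:R)); first exact/base4_expansionS.
by rewrite uv; exact/base4_expansionS.
Qed.

(** [rho] for an arbitrary array of signs. *)
Definition koch_param S (t : R) : plane R :=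
  get [set koch_point p S u | u in [set u | base4_expansion u t]].

Lemma koch_paramE S u (t : R) :
  base4_expansion u t -> koch_param S t = koch_point p S u.
Proof.
move=> ut; have : [set koch_point p S u | u in [set u | base4_expansion u t]] !=set0.
  by exists (koch_point p S u); exists u.
by rewrite /koch_param => -[z hz]; have [v vt <-] := getI hz; exact: koch_point_indep vt ut.
Qed.

Lemma koch_param_rhombus S (t : R) : 0 <= t <= 1 -> V (koch_param S t).
Proof.
move=> /base4_expansion_ex[u ut]; rewrite (koch_paramE _ ut).
exact: koch_point_rhombus.
Qed.

Lemma koch_param0 S : koch_param S 0 = kP_left.
Proof.
have [|u u0] := @base4_expansion_ex R 0; first by rewrite lexx ler01.
by rewrite (koch_paramE _ u0) koch_point_left.
Qed.

Lemma koch_param1 S : koch_param S 1 = kP_right.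
Proof.
have [|u u1] := @base4_expansion_ex R 1; first by rewrite lexx ler01.
by rewrite (koch_paramE _ u1) koch_point_right.
Qed.

(** Prepending the digit [a] to an expansion of [4 * t - a] gives one of [t]; so at a
    common end of two quarters the equation holds for both of them. *)
Lemma koch_param_quarter S (a : 'I_4) (t : R) : 0 <= 4 * t - a%:R <= 1 ->
  koch_param S t = phi p (a, S 0%N 0%N) (koch_param (sub_signs S a) (4 * t - a%:R)).
Proof.
move=> /base4_expansion_ex[u ut].
pose v k := if k is m.+1 then u m else a.
have vt : base4_expansion v t by exact/base4_expansionS.
by rewrite (koch_paramE _ vt) (koch_paramE _ ut) koch_pointE.
Qed.

Lemma koch_param_image S :
  range (koch_point p S) = koch_param S @` `[0, 1].
Proof.
apply/seteqP; split => [_ [u _ <-]|_ [t /= t01 <-]].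
  have [t ut] : exists t, base4_expansion u (t : R).
    have inc : nondecreasing_seq (series (fun k => (u k)%:R / 4 ^+ k.+1 : R)).
      apply: nondecreasing_series => k _ _.
      by rewrite divr_ge0// exprn_ge0.
    exists (sup (range (series (fun k => (u k)%:R / 4 ^+ k.+1 : R)))).
    apply: nondecreasing_cvgn => //; exists 1 => _ [n _ <-].
    by have /andP[] := @base4_sum_itv R u n.
  exists t; last exact: koch_paramE.
  by rewrite /= in_itv/= (base4_expansion_itv ut).
have [|u ut] := @base4_expansion_ex R t; first by move: t01; rewrite in_itv.
by exists u => //; rewrite (koch_paramE _ ut).
Qed.

(** Near an end point, the curve stays in the extreme cells, which all contain
    that end of the rhombus. *)
Lemma koch_param_near0 S n (t : R) : 0 <= t <= 4 ^- n ->
  sqdist (koch_param S t) kP_left <= 2 * (p ^+ 2) ^+ n.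
Proof.
elim: n S t => [|n IHn] S t tn.
  move: tn; rewrite expr0 invr1 => t01.
  by rewrite mulr1 (sqdist_rhombus p_gt p_le)//; [exact: koch_param_rhombus|exact: rhombus_left].
have tn4 : 0 <= 4 * t - 0%:R <= 4 ^- n.
  by move: tn; rewrite exprS invfM; lra.
have n1 : (4 ^- n : R) <= 1 by rewrite invf_le1 ?exprn_gt0// exprn_ege1//; lra.
rewrite (@koch_param_quarter S ord0); last by move: tn4 => /=; lra.
rewrite -[X in sqdist _ X](@phi_fix_left ord0 (S 0%N 0%N))//.
by apply: sqdist_phi_le; exact: IHn.
Qed.

Lemma koch_param_near1 S n (t : R) : 0 <= 1 - t <= 4 ^- n ->
  sqdist (koch_param S t) kP_right <= 2 * (p ^+ 2) ^+ n.
Proof.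
elim: n S t => [|n IHn] S t tn.
  move: tn; rewrite expr0 invr1 => t01.
  rewrite mulr1 (sqdist_rhombus p_gt p_le)//; last exact: rhombus_right.
  by apply: koch_param_rhombus; lra.
have tn4 : 0 <= 1 - (4 * t - 3%:R) <= 4 ^- n.
  by move: tn; rewrite exprS invfM; lra.
have n1 : (4 ^- n : R) <= 1 by rewrite invf_le1 ?exprn_gt0// exprn_ege1//; lra.
rewrite (@koch_param_quarter S ord_max); last by move: tn4 => /=; lra.
rewrite -[X in sqdist _ X](@phi_fix_right ord_max (S 0%N 0%N))//.
by apply: sqdist_phi_le; exact: IHn.
Qed.

(** Two parameters at distance at most [4 ^- n.+1] lie in a common quarter, which
    is handled by self-similarity, or in two consecutive ones, whose cells meet
    in the point that ends the one and starts the other. *)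
Lemma koch_param_modulus S n (t t' : R) : 0 <= t <= 1 -> 0 <= t' <= 1 ->
  `|t - t'| <= 4 ^- n ->
  sqdist (koch_param S t) (koch_param S t') <= 8 * (p ^+ 2) ^+ n.
Proof.
wlog tt' : t t' / t <= t'.
  move=> H t01 t01'; have [tt'|tt'] := leP t t'; first exact: H.
  by rewrite distrC sqdistC; apply: H => //; exact: ltW.
rewrite ler_norml => t01 t01' /andP[+ _].
elim: n S t t' tt' t01 t01' => [|n IHn] S t t' tt' t01 t01' ttn.
  rewrite expr0 mulr1 (@le_trans _ _ 2)//; last by lra.
  by rewrite (sqdist_rhombus p_gt p_le)//; exact: koch_param_rhombus.
have ttn4 : - 4 ^- n <= 4 * t - 4 * t'.
  by move: ttn; rewrite exprS invfM; lra.
have n1 : (4 ^- n : R) <= 1 by rewrite invf_le1 ?exprn_gt0// exprn_ege1//; lra.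
have [a ta] := quarter_cover t01.
have [ta'|ta'] := lerP (4 * t' - a%:R) 1.
  rewrite !(@koch_param_quarter S a)//; last by lra.
  by apply: sqdist_phi_le; apply: IHn; lra.
have a3 : (a.+1 < 4)%N.
  rewrite ltnNge -(ler_nat R) -natr1; apply/negP; rewrite -natr1.
  by move: t01'; lra.
pose a' := Ordinal a3.
have a'E : a'%:R = a%:R + 1 :> R by rewrite /= natr1.
(* Through the common point: [8 = 2 * (2 + 2)], from the two end point estimates. *)
rewrite (@koch_param_quarter S a)// (@koch_param_quarter S a') a'E; last by lra.
apply: le_trans (sqdist_triangle (phi p (a, S 0%N 0%N) kP_right) _ _) _.
have h1 := @sqdist_phi_le (a, S 0%N 0%N) _ _ n 2
  (@koch_param_near1 (sub_signs S a) n (4 * t - a%:R) _).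
have h2 := @sqdist_phi_le (a', S 0%N 0%N) _ _ n 2
  (@koch_param_near0 (sub_signs S a') n (4 * t' - (a%:R + 1)) _).
have {}h1 := h1 ltac:(lra).
have {}h2 := h2 ltac:(lra).
rewrite (@phi_join a a')// [in X in _ + X]sqdistC.
move: h1; rewrite (@phi_join a a')//; lra.
Qed.

(** Precomposing with [clamp] gives a continuous function on the whole line, so that
    the pieces of [gamma] need no restriction to subspaces. *)
Definition clamp (t : R) : R := Num.max 0 (Num.min 1 t).

Lemma clamp_itv t : 0 <= clamp t <= 1.
Proof. by rewrite /clamp le_max lexx/= ge_max ler01 ge_min lexx. Qed.

Lemma clamp_id t : 0 <= t <= 1 -> clamp t = t.
Proof. by move=> /andP[t0 t1]; rewrite /clamp min_r// max_r. Qed.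

Lemma clamp_dist t t' : `|clamp t - clamp t'| <= `|t - t'|.
Proof.
have clampP x : [\/ x <= 0 /\ clamp x = 0, 0 <= x <= 1 /\ clamp x = x |
                   1 <= x /\ clamp x = 1].
  have [x0|/ltW x0] := leP x 0.
    by constructor 1; split=> //; rewrite /clamp max_l// ge_min x0 orbT.
  have [x1|/ltW x1] := leP x 1.
    by constructor 2; split; rewrite ?x0 ?x1// clamp_id ?x0.
  by constructor 3; split=> //; rewrite /clamp min_l// max_r.
have := ler_norm (t - t'); have := ler_norm (- (t - t')); rewrite normrN => *.
rewrite ler_norml.
by case: (clampP t) => -[? ->]; case: (clampP t') => -[? ->]; lra.
Qed.

Lemma koch_param_clamp_continuous S : continuous (koch_param S \o clamp).
Proof.
apply: (@continuous_geometric_modulus _ _ 8 _ ratio01) => n t t' tn.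
apply: koch_param_modulus; [exact: clamp_itv|exact: clamp_itv|].
exact: le_trans (clamp_dist _ _) tn.
Qed.

End Curve.

(** * Injectivity of the curves *)

Section Injectivity.
Context {R : realType} (p : R).
Context (p_gt : 1 / 4 < p) (p_lt : p < 1 / 3).
Notation V := (rhombus p).
Notation q := (kq p).

Let p_le : p <= 1 / 3. Proof. exact: ltW. Qed.

Lemma rhombus_tip z : V z -> 1 / 2 <= (z.1 : R) -> z = kP_right.
Proof.
rewrite rhombusE//; case: z => x y [/=] h1 h2 h3 h4 hx.
have q0 := kq_gt0 p_gt.
have qx : q * (1 / 2) <= q * x by rewrite ler_pM2l.
have y0 : y = 0 by apply/eqP; rewrite eq_le; apply/andP; split; lra.
suff x2 : x = 1 / 2 by rewrite x2 y0.
apply/eqP; rewrite eq_le hx andbT -(ler_pM2l q0); lra.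
Qed.

Lemma rhombus_opp z : V z -> V (- (z.1 : R), - (z.2 : R)).
Proof. by rewrite rhombusE//; case: z => x y [/=] *; split => /=; lra. Qed.

Lemma rhombus_conj z : V z -> V (z.1, - (z.2 : R)).
Proof. by rewrite rhombusE//; case: z => x y [/=] *; split => /=; lra. Qed.

(** Where [p < 1 / 3] enters: the inclined cells, whose axes make twice the half
    angle of the rhombus with the horizontal, have edges strictly less steep
    than the vertical. *)
Lemma rhombus_tilted_lt z : V z -> z <> kP_right ->
  (1 - 2 * p) * z.1 - q * z.2 < (1 - 2 * p) / 2.
Proof.
move=> Vz zN; rewrite ltNge; apply/negP => h; apply: zN.
apply: rhombus_tip => //; move: Vz; rewrite rhombusE//.
case: z h => x y /= h [/=] h1 h2 h3 h4.
have pg := p_gt; have pl := p_lt; have q0 := kq_gt0 p_gt.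
have d0 : 0 < 2 - 6 * p by lra.
have p0 : 0 <= 4 * p - 1 by lra.
rewrite -(ler_pM2l q0) -(ler_pM2l d0).
have e2 : q ^+ 2 * y = (4 * p - 1) * y by rewrite kq_sqr.
by have := ler_wpM2l p0 h2; have := ler_wpM2l (ltW q0) h; lra.
Qed.

Lemma phi_x_lt_right a z : V z -> z <> kP_right ->
  ((phi p a z).1 : R) < (phi p a kP_right).1.
Proof.
move=> Vz zN; have pg := p_gt.
have zc : (z.1, - (z.2 : R)) <> kP_right.
  by case: z zN {Vz} => x y zN [xE yE]; apply: zN; rewrite xE /kP_right; congr pair; lra.
have := rhombus_tilted_lt Vz zN; have := rhombus_tilted_lt (rhombus_conj Vz) zc.
have x_lt : p * (z.1 : R) < p * (1 / 2).
  rewrite ltr_pM2l; last by lra.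
  by rewrite ltNge; apply/negP => /(rhombus_tip Vz).
move: x_lt; case: z {Vz zN zc} => x y /=.
by case: a => [[[|[|[|[|//]]]] ?] []] /=; lra.
Qed.

Lemma phi_x_gt_left a z : V z -> z <> kP_left ->
  ((phi p a kP_left).1 : R) < (phi p a z).1.
Proof.
move=> Vz zN; pose z' : plane R := (- (z.1 : R), - (z.2 : R)).
have zN' : z' <> kP_right.
  case: z zN @z' {Vz} => x y zN z' [xE yE]; apply: zN; rewrite /kP_left; congr pair; lra.
have := @phi_x_lt_right a z' (rhombus_opp Vz) zN'.
by case: z @z' {Vz zN zN'} => x y z'; case: a => [[[|[|[|[|//]]]] ?] []] /=; lra.
Qed.

Lemma phi_x_le_right a z : V z -> ((phi p a z).1 : R) <= (phi p a kP_right).1.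
Proof.
by move=> Vz; have [->//|/eqP/(phi_x_lt_right a Vz)/ltW] := eqVneq z kP_right.
Qed.

Lemma phi_x_ge_left a z : V z -> ((phi p a kP_left).1 : R) <= (phi p a z).1.
Proof.
by move=> Vz; have [->//|/eqP/(phi_x_gt_left a Vz)/ltW] := eqVneq z kP_left.
Qed.

Lemma phi_x_monotone (a a' : 'I_4) b : (a < a')%N ->
  let r := (phi p (a, b) kP_right).1 : R in let l := (phi p (a', b) kP_left).1 : R in
  r <= l /\ (l <= r -> a' = a.+1 :> nat).
Proof.
have pg := p_gt; have pl := p_lt.
by case: a a' => [[|[|[|[|//]]]] ?] [[|[|[|[|//]]]] ?] //= _; case: b;
  rewrite /phi/=; split=> [|h] //; try (exfalso; move: h); lra.
Qed.

(** Consecutive cells lie side by side, separated by vertical lines that they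
    only touch at their common vertex. *)
Lemma phi_cells_meet (a a' : 'I_4) b z z' : (a < a')%N -> V z -> V z' ->
  phi p (a, b) z = phi p (a', b) z' ->
  [/\ a' = a.+1 :> nat, z = kP_right & z' = kP_left].
Proof.
move=> aa' Vz Vz' e.
have [m1 m2] := phi_x_monotone b aa'.
have hz := phi_x_le_right (a, b) Vz; have hz' := phi_x_ge_left (a', b) Vz'.
split.
- by apply: m2; apply: le_trans hz' _; rewrite -e.
- apply: contrapT => /(phi_x_lt_right (a, b) Vz); rewrite e; lra.
- apply: contrapT => /(phi_x_gt_left (a', b) Vz'); rewrite -e; lra.
Qed.

Lemma phi_inj a : injective (phi p a).
Proof.
move=> z z' e; apply: sqdist_eq0.
have := phi_sqdist p_gt a z z'; rewrite e sqdistzz => /esym/eqP.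
rewrite mulf_eq0 expf_eq0/= => /orP[/eqP p0|/eqP //].
by have pg := p_gt; lra.
Qed.

Let quarter_ratio : 0 <= (4^-1 : R) < 1. Proof. lra. Qed.

(** Only the last cell contains [kP_right], which its similarity fixes, and magnifying the
    last quarter multiplies [1 - t] by 4. *)
Lemma koch_param_eq_right S (t : R) : 0 <= t <= 1 ->
  koch_param p S t = kP_right -> t = 1.
Proof.
move=> t01 h; apply/eqP; rewrite eq_le; apply/andP; split; first by lra.
rewrite -subr_le0; apply: (@geometric_le0 _ _ 1 _ quarter_ratio) => n.
elim: n S t t01 h => [|n IHn] S t t01 h; first by rewrite expr0; lra.
have [a ta] := quarter_cover t01.
move: h; rewrite (koch_param_quarter _ _ _ ta)//.
set z := koch_param _ _ _ => h.
have Vz : V z by exact: koch_param_rhombus.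
have a3 : a = 3%N :> nat.
  have := phi_x_le_right (a, S 0%N 0%N) Vz; rewrite h.
  have pl := p_lt; have pg := p_gt.
  by case: a {ta z h Vz} => [[|[|[|[|//]]]] ?] //; case: (S 0%N 0%N); rewrite /phi/= => ?;
    exfalso; lra.
have zE : z = kP_right by apply: (@phi_inj (a, S 0%N 0%N)); rewrite h phi_fix_right.
have := IHn _ _ ta zE; rewrite a3 exprS; lra.
Qed.

Lemma koch_param_eq_left S (t : R) : 0 <= t <= 1 ->
  koch_param p S t = kP_left -> t = 0.
Proof.
move=> t01 h; apply/eqP; rewrite eq_le; apply/andP; split; last by lra.
apply: (@geometric_le0 _ _ 1 _ quarter_ratio) => n.
elim: n S t t01 h => [|n IHn] S t t01 h; first by rewrite expr0; lra.
have [a ta] := quarter_cover t01.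
move: h; rewrite (koch_param_quarter _ _ _ ta)//.
set z := koch_param _ _ _ => h.
have Vz : V z by exact: koch_param_rhombus.
have a0 : a = 0%N :> nat.
  have := phi_x_ge_left (a, S 0%N 0%N) Vz; rewrite h.
  have pl := p_lt; have pg := p_gt.
  by case: a {ta z h Vz} => [[|[|[|[|//]]]] ?] //; case: (S 0%N 0%N); rewrite /phi/= => ?;
    exfalso; lra.
have zE : z = kP_left by apply: (@phi_inj (a, S 0%N 0%N)); rewrite h phi_fix_left.
have := IHn _ _ ta zE; rewrite a0 exprS; lra.
Qed.

(** Parameters in one quarter are separated by magnifying it, parameters in different
    quarters by [phi_cells_meet]. *)
Lemma koch_param_inj S (t t' : R) : 0 <= t <= 1 -> 0 <= t' <= 1 ->
  koch_param p S t = koch_param p S t' -> t = t'.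
Proof.
wlog tt' : t t' / t <= t'.
  move=> H t01 t01' e; have [tt'|/ltW tt'] := leP t t'; first exact: H.
  by apply/esym/H.
move=> t01 t01' h; apply/eqP; rewrite eq_le tt'/= -subr_le0.
apply: (@geometric_le0 _ _ 1 _ quarter_ratio) => n.
elim: n S t t' tt' t01 t01' h => [|n IHn] S t t' tt' t01 t01' h.
  by rewrite expr0; lra.
have n0 : 0 <= 1 * (4^-1 : R) ^+ n.+1 by rewrite mul1r exprn_ge0.
have [a ta] := quarter_cover t01; have [a' ta'] := quarter_cover t01'.
move: h; rewrite (koch_param_quarter _ _ _ ta)// (koch_param_quarter _ _ _ ta')//.
case: (ltngtP a a') => [aa'|aa'|/val_inj aa'] h.
- have [a'E zE zE'] := phi_cells_meet aa' (koch_param_rhombus p_gt p_le _ ta)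
                                      (koch_param_rhombus p_gt p_le _ ta') h.
  have := koch_param_eq_right ta zE; have := koch_param_eq_left ta' zE'.
  by rewrite a'E -(natr1 a); lra.
- have : (a'%:R : R) + 1 <= a%:R by rewrite natr1 ler_nat.
  lra.
- move: ta' h; rewrite -{}aa' => ta' /phi_inj/IHn.
  by rewrite exprS => /(_ ltac:(lra) ta ta'); lra.
Qed.

End Injectivity.

(** * Loops and Jordan curves *)

Section CompactQuotient.

(** A continuous map on a compact set, onto a Hausdorff image, is a quotient map. *)
Lemma within_continuous_factor (T X Y : topologicalType) (K : set T)
    (e : T -> X) (g : T -> Y) (f : X -> Y) :
  hausdorff_space X -> compact K ->
  {within K, continuous e} -> {within K, continuous g} ->
  (forall a, K a -> f (e a) = g a) -> {within e @` K, continuous f}.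
Proof.
move=> hX cK ce cg fe; apply/continuous_closedP => C cC.
have /closed_subspaceP[W cW WE] : closed (g @^-1` C : set (subspace K)).
  by move/continuous_closedP: cg; exact.
have KC : K `&` W = K `&` g @^-1` C by rewrite setIC WE setIC.
apply/closed_subspaceP; exists (e @` (K `&` W)).
  apply: compact_closed => //; apply: continuous_compact.
    by apply: continuous_subspaceW ce => x [].
  exact: compact_closedI.
apply/seteqP; split => [x [[a [Ka Wa] <-] xK]|x [fx [a Ka ae]]].
  split; last by exists a.
  have : (K `&` g @^-1` C) a by rewrite -KC.
  by move=> [_ gC]; rewrite /preimage /from_subspace /= fe.
move: fx; rewrite -ae => fx; split; last by exists a.
exists a => //; rewrite KC; split=> //.
by move: fx; rewrite /preimage /from_subspace /= fe.
Qed.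

Lemma same_fibres_homeomorphic (T : ptopologicalType) (X Y : topologicalType)
    (K : set T) (e : T -> X) (g : T -> Y) :
  hausdorff_space X -> hausdorff_space Y -> compact K ->
  {within K, continuous e} -> {within K, continuous g} ->
  (forall a b, K a -> K b -> e a = e b <-> g a = g b) ->
  homeomorphic (e @` K) (g @` K).
Proof.
move=> hX hY cK ce cg fibres.
have lift (Z : Type) (h : T -> Z) a : K a ->
    [set b | K b /\ h b = h a] (get [set b | K b /\ h b = h a]).
  by move=> Ka; apply: getPex; exists a.
have fe a : K a -> g (get [set b | K b /\ e b = e a]) = g a.
  by move=> Ka; have [Kb] := lift _ e a Ka; exact: (fibres _ _ _ _).1.
have ge a : K a -> e (get [set b | K b /\ g b = g a]) = e a.
  by move=> Ka; have [Kb] := lift _ g a Ka; exact: (fibres _ _ _ _).2.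
exists (fun x => g (get [set b | K b /\ e b = x])),
       (fun y => e (get [set b | K b /\ g b = y])); split.
- exact: within_continuous_factor cg _.
- exact: within_continuous_factor ce _.
- by move=> _ [_ [a Ka <-] <-]; exists a => //; rewrite fe.
- by move=> _ [_ [a Ka <-] <-]; exists a => //; rewrite ge.
- by split => x; rewrite inE => -[a Ka <-]; rewrite ?(fe a Ka, ge a Ka).
Qed.

End CompactQuotient.

Section ClosedCurves.
Context {R : realType}.

(** The fibres of such a loop are those of the identification of 1 with 0. *)
Lemma loop_fibres (X : Type) (g : R -> X) : g 0 = g 1 ->
  {in `[0, 1[ &, injective g} ->
  forall a b, `[0, 1]%classic a -> `[0, 1]%classic b ->
  g a = g b <-> (if a == 1 then 0 else a) = (if b == 1 then 0 else b).
Proof.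
move=> g01 gi; pose red (a : R) : R := if a == 1 then 0 else a.
have gred a : g (red a) = g a by rewrite /red; case: eqP => // ->.
have redI a : `[0, 1]%classic a -> red a \in `[0, 1[.
  rewrite /= !in_itv/= /red; case: eqVneq => [_ _|a1 /andP[a0 al]].
    by rewrite lexx ltr01.
  by rewrite a0 lt_neqAle a1.
move=> a b /redI ra /redI rb; rewrite -/(red a) -/(red b) -(gred a) -(gred b).
by split=> [/gi->//|->].
Qed.

Definition circle_param (t : R) : plane R := (cos (2 * pi * t), sin (2 * pi * t)).

Lemma circle_param_continuous : continuous circle_param.
Proof.
move=> t.
have hc : {for t, continuous (cos \o ( *%R (2 * pi)))}.
  by apply: continuous_comp; [exact: mulrl_continuous|exact: continuous_cos].
have hs : {for t, continuous (sin \o ( *%R (2 * pi)))}.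
  by apply: continuous_comp; [exact: mulrl_continuous|exact: continuous_sin].
exact: cvg_pair hc hs.
Qed.

Lemma circle_param01 : circle_param 0 = circle_param 1.
Proof.
by rewrite /circle_param mulr0 mulr1 cos0 sin0 mulrC mulr_natr cos2pi sin2pi.
Qed.

Lemma cos_2pi_sub (x : R) : cos (2 * pi - x) = cos x.
Proof. by rewrite -cosN opprB [2 * pi]mulrC mulr_natr -cosD2pi subrK. Qed.

(** The sign of the sine tells the two halves of the circle apart, and the cosine is
    injective on each. *)
Lemma circle_param_inj : {in `[0, 1[ &, injective circle_param}.
Proof.
have pi0 := pi_gt0 R.
move=> a b; rewrite !in_itv /circle_param => /= a01 b01 [].
have : 0 <= 2 * pi * a < 2 * pi by nra.
have : 0 <= 2 * pi * b < 2 * pi by nra.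
suff H (x y : R) : 0 <= y < 2 * pi -> 0 <= x < 2 * pi ->
    cos x = cos y -> sin x = sin y -> x = y.
  by move=> hb ha hc hs; have /mulfI := H _ _ hb ha hc hs; apply; lra.
have sneg (z : R) : pi < z < 2 * pi -> sin z < 0.
  move=> hz; rewrite -[z](subrK pi) sinDpi oppr_lt0; apply: sin_gt0_pi; lra.
move=> hy hx hc hs.
have [xp|px] := leP x pi; have [yp|py] := leP y pi.
- by apply: cos_inj => //; rewrite in_itv/=; lra.
- have := sneg y; have := @sin_ge0_pi R x; rewrite hs; lra.
- have := sneg x; have := @sin_ge0_pi R y; rewrite hs; lra.
- suff : 2 * pi - x = 2 * pi - y by lra.
  by apply: cos_inj; rewrite ?in_itv/= ?cos_2pi_sub//; lra.
Qed.

(** The upper half of the circle is reached through [acos], the lower half by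
    symmetry. *)
Lemma circle_param_image : circle_param @` `[0, 1] = @unit_circle R.
Proof.
have pi0 := pi_gt0 R.
apply/seteqP; split => [_ [t _ <-]|[x y]].
  by rewrite /unit_circle /circle_param /= cos2Dsin2.
rewrite /unit_circle /= => xy1; have x1 : -1 <= x <= 1.
  have y2 : 0 <= y ^+ 2 := sqr_ge0 y.
  rewrite -ler_norml -(@ler_pXn2r _ 2)// ?nnegrE// real_normK ?num_real// expr1n.
  by lra.
have a0 := acos_ge0 x1; have api := acos_lepi x1.
have cE : cos (acos x) = x by apply: acosK; rewrite in_itv.
have sE : sin (acos x) = `|y|.
  by rewrite sin_acos// -xy1 addrAC subrr add0r sqrtr_sqr.
have [y0|y0] := leP 0 y.
  exists (acos x / (2 * pi)); last first.
    by rewrite /circle_param mulrC divfK ?cE ?sE ?ger0_norm//; lra.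
  by rewrite /= in_itv/= divr_ge0 ?ler_pdivrMr; lra.
exists (1 - acos x / (2 * pi)); last first.
  rewrite /circle_param mulrBr mulr1 [X in _ - X]mulrC divfK; last by lra.
  rewrite cos_2pi_sub cE -[2 * pi - _]opprB sinN [2 * pi]mulrC mulr_natr.
  by rewrite -sinD2pi subrK sE ltr0_norm ?opprK.
rewrite /= in_itv/=; have : acos x / (2 * pi) <= 1 by rewrite ler_pdivrMr; lra.
have : 0 <= acos x / (2 * pi) by rewrite divr_ge0; lra.
lra.
Qed.

Lemma loop_jordan (g : R -> plane R) :
  {within `[0, 1], continuous g} -> g 0 = g 1 ->
  {in `[0, 1[ &, injective g} -> jordan_curve (g @` `[0, 1]).
Proof.
move=> cg g01 gi; rewrite /jordan_curve -circle_param_image.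
apply: same_fibres_homeomorphic => //.
- exact: segment_compact.
- exact/continuous_subspaceT/circle_param_continuous.
move=> a b Ka Kb; rewrite (loop_fibres circle_param01 circle_param_inj)//.
by rewrite (loop_fibres g01 gi).
Qed.

End ClosedCurves.

(** * The snowflake *)

Section Snowflake.
Context {R : realType} (p : R).
Context (p_gt : 1 / 4 < p) (p_le : p <= 1 / 3).
Notation V := (rhombus p).
Implicit Types z w : plane R.

Let sqrt3_sqr : Num.sqrt 3 ^+ 2 = 3 :> R.
Proof. by rewrite sqr_sqrtr//; lra. Qed.

Definition kP_bottom : plane R := (0, - (Num.sqrt 3 / 2)).

Lemma f1_left : f1 kP_left = kP_right :> plane R.
Proof. by rewrite /f1/=; congr pair; lra. Qed.

Lemma f1_right : f1 kP_right = kP_bottom.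
Proof. by rewrite /f1/=; congr pair; lra. Qed.

Lemma f2_left : f2 kP_left = kP_bottom.
Proof. by rewrite /f2/=; congr pair; lra. Qed.

Lemma f2_right : f2 kP_right = kP_left :> plane R.
Proof. by rewrite /f2/=; congr pair; lra. Qed.

(** [f1] and [f2] are the rotations by two thirds and one third of a turn about the centre
    of the triangle. *)
Lemma f2_f2 z : f2 (f2 z) = f1 z.
Proof.
case: z => x y; have := sqrt3_sqr => h.
have hx : Num.sqrt 3 ^+ 2 * x = 3 * x by rewrite h.
have hy : Num.sqrt 3 ^+ 2 * y = 3 * y by rewrite h.
by rewrite /f1 /f2/=; congr pair; lra.
Qed.

Lemma f2_sqdist z w : sqdist (f2 z) (f2 w) = sqdist z w.
Proof.
case: z w => [x y] [x' y']; rewrite /sqdist /f2 /=.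
have : Num.sqrt 3 ^+ 2 * ((x - x') ^+ 2 + (y - y') ^+ 2) =
  3 * ((x - x') ^+ 2 + (y - y') ^+ 2) by rewrite sqrt3_sqr.
lra.
Qed.

Lemma f2_inj : injective (@f2 R).
Proof. by move=> z w e; apply: sqdist_eq0; rewrite -f2_sqdist e sqdistzz. Qed.

Lemma f1_inj : injective (@f1 R).
Proof. by move=> z w; rewrite -!f2_f2 => /f2_inj/f2_inj. Qed.

Lemma f2_continuous : continuous (@f2 R).
Proof. by apply: sqdist_nonexpansive_continuous => z w; rewrite f2_sqdist. Qed.

Lemma f1_continuous : continuous (@f1 R).
Proof.
by apply: sqdist_nonexpansive_continuous => z w; rewrite -!f2_f2 !f2_sqdist.
Qed.

(** The closed form of each piece also holds at its right end, where it agrees with the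
    next piece at a vertex of the triangle. *)
Lemma gamma_first s t r (x : R) : 0 <= x <= 1 / 3 ->
  gamma p s t r x = koch_param p (signs_of s) (1 - 3 * x).
Proof.
move=> x01; rewrite /gamma; case: ltP => [//|h].
have -> : x = 1 / 3 by lra.
case: ltP => [_|?]; last by exfalso; lra.
have -> : 2 - 3 * (1 / 3) = 1 :> R by lra.
have -> : 1 - 3 * (1 / 3) = 0 :> R by lra.
rewrite -[rho p r 1]/(koch_param p (signs_of r) 1).
by rewrite koch_param1// koch_param0// f2_right.
Qed.

Lemma gamma_second s t r (x : R) : 1 / 3 <= x <= 2 / 3 ->
  gamma p s t r x = f2 (koch_param p (signs_of r) (2 - 3 * x)).
Proof.
move=> x01; rewrite /gamma; case: ltP => [?|_]; first by exfalso; lra.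
case: ltP => [//|h].
have -> : x = 2 / 3 by lra.
have -> : 3 - 3 * (2 / 3) = 1 :> R by lra.
have -> : 2 - 3 * (2 / 3) = 0 :> R by lra.
rewrite -[rho p t 1]/(koch_param p (signs_of t) 1).
by rewrite koch_param1// koch_param0// f1_right f2_left.
Qed.

Lemma gamma_third s t r (x : R) : 2 / 3 <= x <= 1 ->
  gamma p s t r x = f1 (koch_param p (signs_of t) (3 - 3 * x)).
Proof.
move=> x01; rewrite /gamma; case: ltP => [?|_]; first by exfalso; lra.
by case: ltP => [?|_ //]; exfalso; lra.
Qed.

Lemma gamma01 s t r : gamma p s t r 0 = gamma p s t r 1.
Proof.
rewrite gamma_first; last by lra.
rewrite gamma_third; last by lra.
rewrite mulr0 subr0 mulr1 subrr.
by rewrite koch_param1// koch_param0// f1_left.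
Qed.

Lemma gamma_continuous s t r : {within `[0, 1], continuous (gamma p s t r)}.
Proof.
have affine c : continuous (fun x : R => c - 3 * x).
  move=> x; apply: cvgB; first exact: cvg_cst.
  by apply: cvgMr; exact: cvg_id.
have piece S c : continuous ((koch_param p S \o clamp) \o (fun x : R => c - 3 * x)).
  move=> x; apply: continuous_comp; first exact: affine.
  exact: koch_param_clamp_continuous.
have -> : `[0, 1]%classic = `[0, 1 / 3] `|` (`[1 / 3, 2 / 3] `|` `[2 / 3, 1]) :> set R.
  apply/seteqP; split => x /=; rewrite !in_itv /=.
    move=> x01; have [|h1] := leP x (1 / 3); first by left; lra.
    by right; have [|h2] := leP x (2 / 3); [left|right]; lra.
  by case=> [|[]]; lra.
apply: withinU_continuous; [exact: itv_closed|by apply: closedU; exact: itv_closed| |].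
  apply: (@subspace_eq_continuous _ _ _
    ((koch_param p (signs_of s) \o clamp) \o (fun x : R => 1 - 3 * x))).
    move=> x; rewrite inE/= in_itv/= => x01.
    by rewrite /from_subspace gamma_first//= clamp_id//; lra.
  exact/continuous_subspaceT/piece.
apply: withinU_continuous; [exact: itv_closed|exact: itv_closed| |].
  apply: (@subspace_eq_continuous _ _ _
    (f2 \o ((koch_param p (signs_of r) \o clamp) \o (fun x : R => 2 - 3 * x)))).
    move=> x; rewrite inE/= in_itv/= => x01.
    by rewrite /from_subspace gamma_second//= clamp_id//; lra.
  apply: continuous_subspaceT => x; apply: continuous_comp; [exact: piece|exact: f2_continuous].
apply: (@subspace_eq_continuous _ _ _
    (f1 \o ((koch_param p (signs_of t) \o clamp) \o (fun x : R => 3 - 3 * x)))).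
  move=> x; rewrite inE/= in_itv/= => x01.
  by rewrite /from_subspace gamma_third//= clamp_id//; lra.
apply: continuous_subspaceT => x; apply: continuous_comp; [exact: piece|exact: f1_continuous].
Qed.

Lemma gamma_image s t r : gamma p s t r @` `[0, 1] = snowflake p s t r.
Proof.
have curveE u : koch_curve p u = koch_param p (signs_of u) @` `[0, 1].
  by rewrite -koch_param_image.
rewrite /snowflake !curveE; apply/seteqP; split.
  move=> _ [x /= + <-]; rewrite in_itv /= => x01.
  have [h1|h1] := leP x (1 / 3).
    rewrite gamma_first; last by lra.
    by left; left; exists (1 - 3 * x) => //=; rewrite in_itv /=; lra.
  have [h2|h2] := leP x (2 / 3).
    rewrite gamma_second; last by lra.
    right; exists (koch_param p (signs_of r) (2 - 3 * x)) => //.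
    by exists (2 - 3 * x) => //=; rewrite in_itv /=; lra.
  rewrite gamma_third; last by lra.
  left; right; exists (koch_param p (signs_of t) (3 - 3 * x)) => //.
  by exists (3 - 3 * x) => //=; rewrite in_itv /=; lra.
move=> z [[]|].
- move=> [x /= + <-]; rewrite in_itv /= => x01.
  exists ((1 - x) / 3); first by rewrite /= in_itv /=; lra.
  rewrite gamma_first; last by lra.
  by congr koch_param; lra.
- move=> [_ [x /= + <-] <-]; rewrite in_itv /= => x01.
  exists ((3 - x) / 3); first by rewrite /= in_itv /=; lra.
  rewrite gamma_third; last by lra.
  by congr (f1 (koch_param _ _ _)); lra.
- move=> [_ [x /= + <-] <-]; rewrite in_itv /= => x01.
  exists ((2 - x) / 3); first by rewrite /= in_itv /=; lra.
  rewrite gamma_second; last by lra.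
  by congr (f2 (koch_param _ _ _)); lra.
Qed.

Lemma snowflake_jordan s t r :
  {in `[0, 1[ &, injective (gamma p s t r)} -> jordan_curve (snowflake p s t r).
Proof.
move=> gi; rewrite -gamma_image; apply: loop_jordan gi.
  exact: gamma_continuous.
exact: gamma01.
Qed.

End Snowflake.

Section SnowflakeInjective.
Context {R : realType} (p : R).
Context (p_gt : 1 / 4 < p) (p_lt : p < 1 / 3).
Notation V := (rhombus p).
Implicit Types z w : plane R.

Let p_le : p <= 1 / 3. Proof. exact: ltW. Qed.

Let sqrt3_sqr : Num.sqrt 3 ^+ 2 = 3 :> R.
Proof. by rewrite sqr_sqrtr//; lra. Qed.

(** The two edges of the sector that contains the rhombus: these affine forms vanish
    on the rays from the centre of the triangle through [kP_right] and [kP_left]. *)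
Definition right_edge z : R := Num.sqrt 3 * (z.2 : R) + 1 / 2 - (z.1 : R).
Definition left_edge z : R := Num.sqrt 3 * (z.2 : R) + 1 / 2 + (z.1 : R).

Lemma right_edge_f1 z : right_edge (f1 z) = - left_edge z.
Proof.
case: z => x y; rewrite /right_edge /left_edge /f1 /=.
have hx : Num.sqrt 3 ^+ 2 * x = 3 * x by rewrite sqrt3_sqr.
have := sqrt3_sqr; lra.
Qed.

Lemma left_edge_f2 z : left_edge (f2 z) = - right_edge z.
Proof.
case: z => x y; rewrite /right_edge /left_edge /f2 /=.
have hx : Num.sqrt 3 ^+ 2 * x = 3 * x by rewrite sqrt3_sqr.
have := sqrt3_sqr; lra.
Qed.

(** The edges of the rhombus make an angle of less than 30 degrees with the side of the
    triangle, and the rays to the centre one of exactly 30 degrees. *)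
Lemma sqrt3_kq_lt1 : Num.sqrt 3 * kq p < 1.
Proof.
have pg := p_gt; have pl := p_lt.
by rewrite -sqrtrM ?ler0n// -[ltRHS]sqrtr1 ltr_sqrt; lra.
Qed.

Lemma right_edge_gt0 z : V z -> z <> kP_right -> 0 < right_edge z.
Proof.
move=> Vz zN; rewrite ltNge; apply/negP => h; apply/zN/(rhombus_tip p_gt Vz).
move: Vz h; rewrite rhombusE//; case: z {zN} => x y [/=] h1 h2 h3 h4; rewrite /right_edge /= => h.
have d0 : 0 < 1 - Num.sqrt 3 * kq p by have := sqrt3_kq_lt1; lra.
have s0 : 0 <= Num.sqrt 3 :> R by rewrite sqrtr_ge0.
by rewrite -(ler_pM2l d0); have := ler_wpM2l s0 h2; lra.
Qed.

Lemma left_edge_gt0 z : V z -> z <> kP_left -> 0 < left_edge z.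
Proof.
case: z => x y Vz zN.
have -> : left_edge (x, y) = right_edge (- (x : R), y).
  by rewrite /left_edge /right_edge /=; lra.
apply: right_edge_gt0.
  by have /= := rhombus_opp p_gt (rhombus_conj p_gt Vz); rewrite opprK.
by move=> [xE yE]; apply: zN; rewrite yE /kP_left; congr pair; lra.
Qed.

Lemma right_edge_ge0 z : V z -> 0 <= right_edge z.
Proof.
move=> Vz; have [->|/eqP/(right_edge_gt0 Vz)/ltW//] := eqVneq z kP_right.
by rewrite /right_edge /=; lra.
Qed.

Lemma left_edge_ge0 z : V z -> 0 <= left_edge z.
Proof.
move=> Vz; have [->|/eqP/(left_edge_gt0 Vz)/ltW//] := eqVneq z kP_left.
by rewrite /left_edge /=; lra.
Qed.

(** The rotation carries [left_edge] to the opposite of [right_edge], whereas both are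
    nonnegative on the rhombus. *)
Lemma rhombus_f1_meet z w : V z -> V w -> f1 z = w -> z = kP_left.
Proof.
move=> Vz Vw e; apply: contrapT => /(left_edge_gt0 Vz) z0.
by have := right_edge_ge0 Vw; rewrite -e right_edge_f1; lra.
Qed.

Lemma rhombus_f2_meet z w : V z -> V w -> f2 z = w -> z = kP_right /\ w = kP_left.
Proof.
move=> Vz Vw e.
have := left_edge_f2 z; rewrite e => ew; have w0 := left_edge_ge0 Vw.
have z0 := right_edge_ge0 Vz.
split; apply: contrapT.
- by move=> /(right_edge_gt0 Vz); lra.
- by move=> /(left_edge_gt0 Vw); lra.
Qed.

(** On [[0, 1[], each piece runs through the parameters of its curve without 0, hence
    misses the image of [kP_left]; but a common point of two pieces is such an image for
    one of them. *)
Lemma gamma_inj s t r : {in `[0, 1[ &, injective (gamma p s t r)}.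
Proof.
have W S (c x : R) : 0 <= c - 3 * x <= 1 -> V (koch_param p S (c - 3 * x)).
  exact: koch_param_rhombus.
move=> x y; wlog xy : x y / x <= y.
  move=> H hx hy e; have [xy|/ltW xy] := leP x y; first exact: H.
  by apply/esym/H.
rewrite !in_itv/= => x01 y01.
have [x1|x1] := ltP x (1 / 3).
  rewrite gamma_first//; last by lra.
  have [y1|y1] := ltP y (1 / 3).
    rewrite gamma_first//; last by lra.
    by move/(koch_param_inj p_gt p_lt); lra.
  have [y2|y2] := ltP y (2 / 3).
    rewrite gamma_second//; last by lra.
    move=> /esym/rhombus_f2_meet[]; [apply: W; lra|apply: W; lra|].
    by move=> _ /(koch_param_eq_left p_gt p_lt); lra.
  rewrite gamma_third//; last by lra.
  move=> /esym/rhombus_f1_meet h; have {h} := h (W _ _ _ _) (W _ _ _ _).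
  by move=> /(_ ltac:(lra) ltac:(lra))/(koch_param_eq_left p_gt p_lt); lra.
have [x2|x2] := ltP x (2 / 3).
  rewrite gamma_second//; last by lra.
  have [y2|y2] := ltP y (2 / 3).
    rewrite gamma_second//; last by lra.
    by move/f2_inj/(koch_param_inj p_gt p_lt); lra.
  rewrite gamma_third// -?f2_f2; last by lra.
  move=> /f2_inj/esym/rhombus_f2_meet[]; [apply: W; lra|apply: W; lra|].
  by move=> _ /(koch_param_eq_left p_gt p_lt); lra.
rewrite !gamma_third//; try lra.
by move/f1_inj/(koch_param_inj p_gt p_lt); lra.
Qed.

End SnowflakeInjective.

Theorem proposition3p2 (R : realType) (p : R) (s r t : koch_signs) :
  1 / 4 < p -> p <= 1 / 3 ->
  ({in `[0, 1[ &, injective (gamma p s t r)} -> jordan_curve (snowflake p s t r)) /\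
  (p < 1 / 3 ->
     {in `[0, 1[ &, injective (gamma p s t r)} /\ jordan_curve (snowflake p s t r)).
Proof.
move=> p_gt p_le; split; first exact: snowflake_jordan.
move=> p_lt; have gi := @gamma_inj _ _ p_gt p_lt s t r.
by split=> //; exact: snowflake_jordan.
Qed.
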